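(* Let $n\geq3$ and $\omega\in H^0(\mathbb{P}^n,\Omega^1_{\mathbb{P}^n}(e))$. Then $J(\omega)\subset I(\omega)$ if and only if $\omega\wedge d\omega=0$.
   Context: Let $S=\mathbb{C}[x_0,\dots,x_n]$ be the homogeneous coordinate ring of $\mathbb{P}^n$ over $\mathbb{C}$. $\Omega^1_S$ is the free $S$-module of Kähler differentials of $S$ over $\mathbb{C}$ (basis $dx_0,\dots,dx_n$) and $T_S=(\Omega^1_S)^\vee$ is the module of polynomial vector fields. A section $\omega\in H^0(\mathbb{P}^n,\Omega^1_{\mathbb{P}^n}(e))$ is identified with a form $\omega=\sum_{i=0}^n A_i\,dx_i\in\Omega^1_S$, with $A_i$ homogeneous of degree $e-1$ and $\sum_i x_iA_i=0$; $d\omega$ is its exterior derivative. Its ideal of first order unfoldings is $I(\omega)=\{h\in S: h\,d\omega=\omega\wedge\eta\text{ for some }\eta\in\Omega^1_S\}$ and its ideal of trivial first order unfoldings is $J(\omega)=\{i_X(\omega)\in S: X\in T_S\}$. *)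

(* Defs.v *)
From HB Require Import structures.
From mathcomp Require Import all_boot all_order all_algebra.
From mathcomp Require Import reals.
From mathcomp.real_closed Require Import complex.
From mathcomp Require Import mpoly.

Set Implicit Arguments.
Unset Strict Implicit.
Unset Printing Implicit Defensive.

Import GRing.Theory.
Local Open Scope ring_scope.

Section PolynomialForms.
Variables (C : comNzRingType) (m : nat).
Local Notation S := {mpoly C[m]}.

(* A row vector A stands for the form \sum_i (A 0 i) dx_i. *)
Definition Omega1 := 'rV[S]_m.

Definition vfield := {linear Omega1 -> S^o}.

Definition contract (X : vfield) (omega : Omega1) : S := X omega.

(* The exterior algebra of Omega1: alpha K is the coefficient of
   dx_(k_1) /\ ... /\ dx_(k_r), where K = {k_1 < ... < k_r}. *)
Definition diff_form := {ffun {set 'I_m} -> S^o}.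

Definition form1 (omega : Omega1) : diff_form :=
  [ffun K : {set 'I_m} => \sum_(i | K == [set i]) omega 0 i].

Definition inversions (I J : {set 'I_m}) : nat :=
  #|[set p : 'I_m * 'I_m | [&& p.1 \in I, p.2 \in J & (p.2 < p.1)%N]]|.

(* For disjoint I and J, dx_I /\ dx_J = (-1)^(inversions I J) dx_(I u J). *)
Definition wedge (alpha beta : diff_form) : diff_form :=
  [ffun K : {set 'I_m} => \sum_(I : {set 'I_m} | I \subset K)
     (-1) ^+ inversions I (K :\: I) * (alpha I * beta (K :\: I))].

(* d (f dx_I) = \sum_i (df/dx_i) dx_i /\ dx_I. *)
Definition extd (alpha : diff_form) : diff_form :=
  [ffun K : {set 'I_m} => \sum_(i in K)
     (-1) ^+ inversions [set i] (K :\ i) * mderiv i (alpha (K :\ i))].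

Definition unfolding_ideal (omega : Omega1) (h : S) : Prop :=
  exists eta : Omega1,
    h *: extd (form1 omega) = wedge (form1 omega) (form1 eta).

Definition trivial_unfolding_ideal (omega : Omega1) (h : S) : Prop :=
  exists X : vfield, h = contract X omega.

(* Homogeneity in an integral degree; 0 is homogeneous of every degree, and it
   is the only homogeneous polynomial of negative degree. *)
Definition homogeneous (d : int) (p : S) : Prop :=
  match d with
  | Posz k => p \is k.-homog
  | Negz _ => p = 0
  end.

End PolynomialForms.

(* omega \in H^0(P^n, Omega^1(e)), through the Euler sequence. *)
Definition twisted_section (C : comNzRingType) (n : nat) (e : int)
    (omega : Omega1 C n.+1) : Prop :=
  (forall i, homogeneous (e - 1) (omega 0 i)) /\
  \sum_(i < n.+1) 'X_i * omega 0 i = 0.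

(* Main.v *)
Require Import Defs.
From HB Require Import structures.
From mathcomp Require Import all_boot all_order all_algebra.
From mathcomp Require Import reals.
From mathcomp.real_closed Require Import complex.
From mathcomp Require Import mpoly.
From mathcomp Require Import ring.

(** Write [omega = \sum_i A_i dx_i].  The coefficient [A_i] is the contraction
    of [omega] with the i-th coordinate field, so if [J(omega)] lies in
    [I(omega)], then [A_i d omega = omega /\ eta] for some [eta].  Wedging with
    [omega] kills the right-hand side ([wedge1_nilpotent]), which leaves
    [A_i (omega /\ d omega) = 0].  Polynomials over a domain form a domain, so
    either [omega /\ d omega] vanishes or every [A_i] does, and in the latter
    case [omega = 0].

    Conversely, contraction with a vector field [X] is an antiderivation
    ([interior_wedge1]).  Contracting [omega /\ d omega = 0] therefore gives
    [i_X(omega) d omega = omega /\ i_X(d omega)], and [i_X(d omega)] is a 1-form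
    because [d omega] is concentrated in degree 2.  So [eta = i_X(d omega)]
    shows that [i_X(omega)] belongs to [I(omega)]. *)

Set Implicit Arguments.
Unset Strict Implicit.
Unset Printing Implicit Defensive.

Import GRing.Theory.
Local Open Scope ring_scope.
Local Open Scope complex_scope.

Lemma inversions_setU1 m (i j : 'I_m) (J : {set 'I_m}) : j \notin J ->
  inversions [set i] (j |: J) = ((j < i)%N + inversions [set i] J)%N.
Proof.
move=> jJ; suff inv_sum L :
    inversions [set i] L = (\sum_(l in L) (l < i)%N)%N.
  by rewrite !inv_sum big_setU1.
transitivity #|[set (i, l) | l in [set l in L | (l < i)%N]]|.
  apply: eq_card => -[p q]; rewrite inE /= in_set1.
  apply/and3P/imsetP => [[/eqP-> qL qi]|[l]].
    by exists q; rewrite ?inE ?qL.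
  by rewrite inE => /andP[lL li] [-> ->].
rewrite card_imset; last by move=> ? ? [].
by rewrite -sum1dep_card big_mkcondr; apply: eq_bigr => l _; case: ifP.
Qed.

(** The sign in [dx_i /\ dx_j = - dx_j /\ dx_i]. *)
Lemma sign_ltn_swap (R : pzRingType) m (i j : 'I_m) : i != j ->
  (-1) ^+ (j < i)%N = - (-1) ^+ (i < j)%N :> R.
Proof.
rewrite -val_eqE neq_ltn => /orP[] lt_ij; rewrite lt_ij ltnNge (ltnW lt_ij) /=.
  by rewrite expr0 expr1 opprK.
by rewrite expr0 expr1.
Qed.

Lemma sum_antisymmetric (V : zmodType) m (A : {set 'I_m})
    (F : 'I_m -> 'I_m -> V) :
    (forall i j, i \in A -> j \in A -> i != j -> F i j = - F j i) ->
  \sum_(i in A) \sum_(j in A :\ i) F i j = 0.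
Proof.
move=> antiF.
(* The halves j < i and i < j cancel, which avoids dividing by 2. *)
transitivity (\sum_(i in A) \sum_(j in A | (j < i)%N) F i j
              + \sum_(i in A) \sum_(j in A | (i < j)%N) F i j).
  rewrite -big_split /=; apply: eq_bigr => i iA.
  rewrite (bigID (fun j : 'I_m => (j < i)%N)) /=; congr (_ + _);
    apply: eq_bigl => j; rewrite !inE -val_eqE /=;
    by case: (j \in A); case: ltngtP.
rewrite [X in _ + X](exchange_big_dep (mem A)) /= => [|i j _ /andP[] //].
rewrite -big_split big1 //= => i iA.
rewrite [X in _ + X](eq_big (fun j => (j \in A) && (j < i)%N)
                           (fun j => - F i j)) => [|j|j /and3P[jA _ ji]].
- by rewrite sumrN subrr.
- by rewrite iA.
- by rewrite antiF // -val_eqE neq_ltn ji.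
Qed.

Section Forms.
Variables (C : comNzRingType) (m : nat).
Local Notation S := {mpoly C[m]}.
Local Notation sgn i J := ((-1 : S) ^+ inversions [set i] J).
Implicit Types (omega : Omega1 C m) (beta : diff_form C m).
Implicit Types (i j k : 'I_m) (K : {set 'I_m}).

Lemma wedge1E omega beta K :
  wedge (form1 omega) beta K
    = \sum_(i in K) sgn i (K :\ i) * (omega 0 i * (beta (K :\ i) : S)).
Proof.
rewrite ffunE; under eq_bigr => I _ do rewrite ffunE mulr_suml mulr_sumr.
rewrite (exchange_big_dep (mem K)) /= => [|I i IK /eqP defI].
  apply: eq_bigr => i iK; rewrite (big_pred1 [set i]) // => I.
  by rewrite andb_idl // => /eqP->; rewrite sub1set.
by rewrite -sub1set -defI.
Qed.

(** [omega /\ omega = 0] without an appeal to associativity: the double sum for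
    [omega /\ (omega /\ beta)] is antisymmetric in the two indices contributed
    by [omega]. *)
Lemma wedge1_nilpotent omega beta :
  wedge (form1 omega) (wedge (form1 omega) beta) = 0.
Proof.
apply/ffunP => K; rewrite wedge1E [RHS]ffunE.
under eq_bigr => i _ do rewrite wedge1E !mulr_sumr.
apply: (@sum_antisymmetric S) => i j iK jK nij.
have nji : j != i by rewrite eq_sym.
set L := K :\ i :\ j.
have LE : K :\ j :\ i = L by rewrite /L !setDDl setUC.
rewrite LE.
have -> : K :\ i = j |: L by rewrite /L setD1K // !inE nji.
have -> : K :\ j = i |: L by rewrite -LE setD1K // !inE nij.
rewrite !inversions_setU1 ?inE ?eqxx ?andbF //.
rewrite !exprD (sign_ltn_swap _ nij).
by ring.
Qed.

(** Contraction of a form of arbitrary degree with [\sum_k X_k d/dx_k]; moving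
    [dx_k] to the front of [dx_(k |: K)] costs the sign. *)
Definition interior (X : 'I_m -> S) beta : diff_form C m :=
  [ffun K : {set 'I_m} => \sum_(k | k \notin K)
     sgn k K * (X k * (beta (k |: K) : S))].

(** Contraction is an antiderivation.  At the coefficient of [dx_K], the terms
    of [i_X (omega /\ beta)] and of [omega /\ i_X beta] in which [d/dx_k] meets
    the factor [dx_k] of [omega] have [k \notin K] and [k \in K] respectively,
    so together they make up all of [i_X(omega) beta].  In the mixed terms [d/dx_k]
    meets [beta] while [dx_i] comes from [omega]; the two sides produce these
    with opposite signs, since contraction has to pass [dx_i] on one of them. *)
Lemma interior_wedge1 (X : 'I_m -> S) omega beta :
  interior X (wedge (form1 omega) beta)
    = (\sum_i X i * omega 0 i) *: beta - wedge (form1 omega) (interior X beta).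
Proof.
apply/ffunP => K; set w := wedge _ (interior X beta).
suff main : (interior X (wedge (form1 omega) beta) K : S) + (w K : S)
    = (\sum_i X i * omega 0 i) * (beta K : S).
  rewrite [RHS]ffunE [in RHS]ffunE [X in _ = _ + X]ffunE.
  by rewrite -[_ *: _]main addrK.
have sgn_sqr k L : sgn k L * sgn k L = 1 by rewrite -expr2 sqrr_sign.
pose mixed k i : S := X k * omega 0 i * (beta (k |: (K :\ i)) : S).
have interE : (interior X (wedge (form1 omega) beta) K : S) =
    \sum_(k | k \notin K) (X k * omega 0 k) * (beta K : S)
    + \sum_(k | k \notin K) \sum_(i in K)
        sgn k K * sgn i (k |: (K :\ i)) * mixed k i.
  rewrite ffunE -big_split; apply: eq_bigr => k kK /=.
  rewrite wedge1E big_setU1 //= setU1K // !mulrDr; congr (_ + _).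
    transitivity (sgn k K * sgn k K * (X k * omega 0 k * (beta K : S))).
      by ring.
    by rewrite sgn_sqr mul1r.
  rewrite !mulr_sumr; apply: eq_bigr => i iK.
  have -> : (k |: K) :\ i = k |: (K :\ i).
    apply/setP => l; rewrite !inE; case: (l =P k) => [->|//].
    by rewrite andbT; apply: contraNneq kK => ->.
  by rewrite /mixed; ring.
have wE : (w K : S) =
    \sum_(i in K) (X i * omega 0 i) * (beta K : S)
    + \sum_(i in K) \sum_(k | k \notin K)
        sgn i (K :\ i) * sgn k (K :\ i) * mixed k i.
  rewrite /w wedge1E -big_split; apply: eq_bigr => i iK /=.
  rewrite ffunE (bigD1 i) ?inE ?eqxx //= setD1K // !mulrDr; congr (_ + _).
    transitivity (sgn i (K :\ i) * sgn i (K :\ i)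
                  * (X i * omega 0 i * (beta K : S))).
      by ring.
    by rewrite sgn_sqr mul1r.
  rewrite !mulr_sumr; apply: eq_big => [k|k _].
    by rewrite !inE; case: (k =P i) => [->|]; rewrite ?iK ?andbF ?andbT.
  by rewrite /mixed; ring.
have mixed_cancel : \sum_(k | k \notin K) \sum_(i in K)
      sgn k K * sgn i (k |: (K :\ i)) * mixed k i
    = - \sum_(i in K) \sum_(k | k \notin K)
        sgn i (K :\ i) * sgn k (K :\ i) * mixed k i.
  rewrite exchange_big -sumrN; apply: eq_bigr => i iK.
  rewrite -sumrN; apply: eq_bigr => k kK.
  have nik : i != k by apply: contraNneq kK => <-.
  have kKi : k \notin K :\ i by rewrite inE negb_and kK orbT.
  rewrite -{1}(setD1K iK) !inversions_setU1 ?(negPf kKi) ?setD11 //.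
  by rewrite !exprD (sign_ltn_swap _ nik); case: (i < k)%N; ring.
rewrite interE wE mixed_cancel mulr_suml [RHS](bigID (mem K)) /=.
by ring.
Qed.

Lemma form1_deg1 omega K : #|K| != 1%N -> form1 omega K = 0.
Proof.
by move=> cK; rewrite ffunE big_pred0 // => i; apply: contraNF cK => /eqP->;
  rewrite cards1.
Qed.

Lemma extd_form1_deg2 omega K : #|K| != 2%N -> extd (form1 omega) K = 0.
Proof.
move=> cK; rewrite ffunE big1 // => i iK; rewrite form1_deg1 ?mderiv0 ?mulr0 //.
by apply: contraNneq cK => cKi; rewrite (cardsD1 i) iK cKi.
Qed.

(** Contracting a 2-form gives a 1-form; this supplies the [eta] that exhibits
    [i_X omega] as an element of the unfolding ideal. *)
Lemma interior_deg2 (X : 'I_m -> S) beta :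
    (forall K, #|K| != 2%N -> beta K = 0) ->
  interior X beta = form1 (\row_i interior X beta [set i]).
Proof.
move=> beta2; apply/ffunP => K.
case: (boolP (#|K| == 1%N)) => [/cards1P[i ->]|cK].
  rewrite [RHS]ffunE (big_pred1 i) ?mxE // => j; rewrite [LHS]eq_sym.
  by rewrite /= (inj_eq set1_inj).
rewrite form1_deg1 // ffunE big1 // => k kK.
by rewrite beta2 ?mulr0 // cardsU1 kK.
Qed.

Lemma contract_coords (X : vfield C m) omega :
  contract X omega = \sum_i X (delta_mx 0 i) * omega 0 i.
Proof.
rewrite /contract {1}(row_sum_delta omega) linear_sum.
by apply: eq_bigr => i _; rewrite linearZ /= mulrC.
Qed.

Lemma wedge_scaler (h : S) alpha beta :
  wedge alpha (h *: beta) = h *: wedge alpha beta.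
Proof.
apply/ffunP => K; rewrite [RHS]ffunE !ffunE [RHS]mulr_sumr.
apply: eq_bigr => I _; rewrite ffunE -[_ *: _]/(h * (beta (K :\: I) : S)).
by rewrite (mulrCA _ h) (mulrCA _ h).
Qed.

Lemma coord_trivial_unfolding omega i :
  trivial_unfolding_ideal omega (omega 0 i).
Proof.
pose f (v : Omega1 C m) : S^o := v 0 i.
have lin_f : linear f by move=> a u v; rewrite /f !mxE.
pose F : vfield C m := HB.pack f (GRing.isLinear.Build _ _ _ _ f lin_f).
by exists F.
Qed.

Lemma integrable_unfolding omega (h : S) :
    wedge (form1 omega) (extd (form1 omega)) = 0 ->
  trivial_unfolding_ideal omega h -> unfolding_ideal omega h.
Proof.
move=> int_omega [X ->]; pose Xc i : S := X (delta_mx 0 i).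
exists (\row_i interior Xc (extd (form1 omega)) [set i]).
rewrite -interior_deg2; last exact: extd_form1_deg2.
have := interior_wedge1 Xc omega (extd (form1 omega)).
rewrite int_omega -contract_coords => /esym/eqP.
have -> : interior Xc 0 = 0.
  by apply/ffunP => K; rewrite !ffunE big1 // => k _; rewrite ffunE !mulr0.
by rewrite subr_eq0 => /eqP.
Qed.

End Forms.

(** Membership of the coefficients [A_i] in the unfolding ideal only shows that
    they annihilate [omega /\ d omega]; over a domain they can be cancelled. *)
Lemma unfolding_integrable (C : idomainType) m (omega : Omega1 C m) :
    (forall h, trivial_unfolding_ideal omega h -> unfolding_ideal omega h) ->
  wedge (form1 omega) (extd (form1 omega)) = 0.
Proof.
move=> JI; apply/ffunP => K; rewrite [RHS]ffunE; apply/eqP/negPn/negP => nzK.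
have omega0 i : omega 0 i = 0.
  have [eta def_eta] := JI _ (coord_trivial_unfolding omega i).
  have := wedge_scaler (omega 0 i) (form1 omega) (extd (form1 omega)).
  rewrite def_eta wedge1_nilpotent => /esym/ffunP/(_ K).
  rewrite [LHS]ffunE [RHS]ffunE => /eqP.
  rewrite -[_ *: _]/(omega 0 i * (wedge _ _ K : {mpoly C[m]})).
  by rewrite mulf_eq0 => /orP[/eqP //|]; rewrite (negPf nzK).
by case/eqP: nzK; rewrite wedge1E big1 // => i _; rewrite omega0 mul0r mulr0.
Qed.

Theorem theorem1 (R : realType) (n : nat) (hn : (3 <= n)%N) (e : int)
    (omega : Omega1 R[i] n.+1) (homega : twisted_section e omega) :
  (forall h : {mpoly R[i][n.+1]},
     trivial_unfolding_ideal omega h -> unfolding_ideal omega h) <->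
  wedge (form1 omega) (extd (form1 omega)) = 0.
Proof.
split; first exact: unfolding_integrable.
by move=> int_omega h; apply: integrable_unfolding.
Qed.
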